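(* Let $\Gamma$ be a graphical cake represented by a finite tree of minimal height $h\ge 1$, let two agents $A,B$ have valuations $v_A,v_B$ on $\Gamma$, and let $0\le t\le 1$ with entitlement vector $(t,1-t)$. Then there exists a weighted consensus division $(\alpha,\beta)$ of $\Gamma$ such that each of $\alpha$ and $\beta$ has at most $h+1$ connected components.
   Context: A graphical cake represented by a finite graph $\Gamma=(V,E)$ consists of $|E|$ closed intervals, one per edge, with endpoints identified according to the incidence structure of $\Gamma$. A piece is a finite union of subintervals of edges; its connected pieces are its path components under the endpoint identifications. The minimal height of a tree is the minimum over all vertices $R$ of the height of the tree rooted at $R$ (the maximum distance from $R$ to any vertex). A valuation is a non-atomic Borel probability measure on the cake. A division between two agents is a pair of pieces $(\alpha,\beta)$ with $\alpha\cup\beta=\Gamma$ and $\alpha\cap\beta$ finite. Given entitlements $(t,1-t)$, $0\le t\le1$, a division is a weighted consensus division if $v_A(\alpha)=v_B(\alpha)=t$ and $v_A(\beta)=v_B(\beta)=1-t$. *)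

(* Defs.v *)
From HB Require Import structures.
From mathcomp Require Import all_boot all_order all_algebra.
From mathcomp Require Import all_classical all_reals all_analysis.
Set Implicit Arguments. Unset Strict Implicit. Unset Printing Implicit Defensive.
Import Order.TTheory GRing.Theory Num.Theory.
Local Open Scope classical_set_scope.
Local Open Scope ring_scope.

(* A finite (multi)graph: vertex type V, edge type E, each edge e is the
   interval [0,1] glued at 0 to [src e] and at 1 to [dst e]. *)

Definition adj (V E : finType) (src dst : E -> V) : rel V :=
  fun u w => [exists e : E, ((src e == u) && (dst e == w)) ||
                            ((src e == w) && (dst e == u))].

Definition is_tree (V E : finType) (src dst : E -> V) : Prop :=
  (forall u w : V, connect (adj src dst) u w) /\ #|E|.+1 = #|V|.

Fixpoint within (V E : finType) (src dst : E -> V) (n : nat) (u w : V) : bool :=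
  match n with
  | 0 => u == w
  | n'.+1 => within src dst n' u w ||
             [exists x : V, within src dst n' u x && adj src dst x w]
  end.

Definition height_le (V E : finType) (src dst : E -> V) (r : V) (n : nat) : Prop :=
  forall w : V, within src dst n r w.

Definition minimal_height (V E : finType) (src dst : E -> V) (h : nat) : Prop :=
  (exists r : V, height_le src dst r h) /\
  (forall (r : V) (n : nat), height_le src dst r n -> (h <= n)%N).

Section Cake.
Variables (R : realType) (V E : finType) (src dst : E -> V).

Definition in_cake (p : E * R) : Prop := 0 <= p.2 <= 1.

Definition vertex_of (p : E * R) : option V :=
  if p.2 == 0 then Some (src p.1) else if p.2 == 1 then Some (dst p.1) else None.

Definition same_pt (p q : E * R) : Prop :=
  p = q \/ (exists v, vertex_of p = Some v /\ vertex_of q = Some v).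

(* A piece is a finite union of (closed) subintervals [a,b] of edges,
   given by a list of triples (e, a, b) with 0 <= a <= b <= 1. *)
Definition piece := seq (E * R * R).

Definition wf_piece (P : piece) : Prop :=
  forall i, i \in P -> 0 <= i.1.2 /\ i.1.2 <= i.2 /\ i.2 <= 1.

Definition pset (P : piece) (e : E) : set R :=
  [set x | exists2 i, i \in P & i.1.1 = e /\ i.1.2 <= x <= i.2].

Definition inP (P : piece) (p : E * R) : Prop :=
  exists q, same_pt p q /\ pset P q.1 q.2.

Definition step (P : piece) (p q : E * R) : Prop :=
  (same_pt p q /\ inP P p) \/
  (p.1 = q.1 /\ forall z, Num.min p.2 q.2 <= z <= Num.max p.2 q.2 -> inP P (p.1, z)).

Inductive conn (P : piece) : E * R -> E * R -> Prop :=
| conn_refl p : conn P p p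
| conn_step p q r : step P p q -> conn P q r -> conn P p r.

Definition at_most_components (P : piece) (k : nat) : Prop :=
  exists reps : seq (E * R), (size reps <= k)%N /\
    forall p, in_cake p -> inP P p -> exists2 r, r \in reps & conn P r p.

(* A non-atomic Borel probability measure on the cake; since vertices carry no
   mass, it is the same as a family of non-atomic Borel measures mu e on the
   edges [0,1], with total mass 1. *)
Definition valuation (mu : E -> {measure set R -> \bar R}) : Prop :=
  (forall e, mu e [set x | x < 0 \/ 1 < x] = 0%E) /\
  (forall e x, mu e [set x] = 0%E) /\
  (\sum_(e : E) mu e [set x : R | (0 <= x <= 1)%R] = 1%E)%E.

Definition value (mu : E -> {measure set R -> \bar R}) (P : piece) : \bar R :=
  (\sum_(e : E) mu e (pset P e))%E.

Definition division (alpha beta : piece) : Prop :=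
  wf_piece alpha /\ wf_piece beta /\
  (forall p, in_cake p -> inP alpha p \/ inP beta p) /\
  (forall e : E, finite_set [set x | in_cake (e, x) /\ inP alpha (e, x) /\ inP beta (e, x)]).

Definition weighted_consensus (muA muB : E -> {measure set R -> \bar R}) (t : R)
    (alpha beta : piece) : Prop :=
  division alpha beta /\
  value muA alpha = t%:E /\ value muB alpha = t%:E /\
  value muA beta = (1 - t)%:E /\ value muB beta = (1 - t)%:E.

End Cake.

(* Main.v *)
Require Import Defs.
From HB Require Import structures.
From mathcomp Require Import all_boot all_order all_algebra.
From mathcomp Require Import all_classical all_reals all_analysis.
From mathcomp Require Import zify ring lra.
Set Implicit Arguments. Unset Strict Implicit. Unset Printing Implicit Defensive.
Import Order.TTheory GRing.Theory Num.Theory.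
Import numFieldNormedType.Exports.
Local Open Scope classical_set_scope.
Local Open Scope ring_scope.

(* Root the tree at a vertex of minimal height and concatenate its edges in
   depth-first order into an interval [0, n]. Every point of an initial segment
   is joined to the root inside the segment; what comes after a point on an edge
   at depth d splits into at most d pieces hanging below that edge and its proper
   ancestors other than the root, plus one piece containing the root. Hence for
   x <= y both [x, y] and the closure of its complement have at most h + 1
   components. It remains to find an interval to which both agents give t, or
   both give 1 - t: a chord argument for the difference of the two cumulative
   distribution functions. *)

(* Both names are also defined by MathComp-Analysis. *)
Local Notation within := Defs.within (only parsing).
Local Notation pset := Defs.pset (only parsing).

Lemma uniq_flatten_map (S T : eqType) (f : S -> seq T) (xs : seq S) :
  uniq xs -> {in xs, forall x, uniq (f x)} ->
  {in xs &, forall x y z, z \in f x -> z \in f y -> x = y} ->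
  uniq (flatten [seq f x | x <- xs]).
Proof.
elim: xs => //= x xs IH /andP[xxs uxs] ufs dis.
rewrite cat_uniq ufs ?mem_head // IH //=; first last.
- by move=> y z yxs zxs; apply: dis; rewrite inE ?yxs ?zxs orbT.
- by move=> y yxs; apply: ufs; rewrite inE yxs orbT.
rewrite andbT; apply/hasPn => z /flatten_mapP[y yxs zy]; apply: contra xxs => zx.
by rewrite (dis x y _ _ z) ?mem_head // inE yxs orbT.
Qed.

(** * Depth-first edge orderings of a rooted tree *)

Section Preorder.
Context {V E : finType} (src dst : E -> V).

Definition tail_of (c : E * bool) : V := if c.2 then dst c.1 else src c.1.
Definition head_of (c : E * bool) : V := if c.2 then src c.1 else dst c.1.

(* [preorder d v s]: [s] lists, in depth-first order and oriented away from
   [v], the edges of a tree rooted at [v] of height at most [d]. *)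
Inductive preorder : nat -> V -> seq (E * bool) -> Prop :=
| preorder_nil d v : preorder d v [::]
| preorder_cons d c s1 s2 : preorder d (head_of c) s1 ->
    preorder d.+1 (tail_of c) s2 ->
    preorder d.+1 (tail_of c) (c :: s1 ++ s2).

Lemma preorder_flatten (T : eqType) d v (ws : seq T) (c : T -> E * bool)
    (f : T -> seq (E * bool)) :
  {in ws, forall w, tail_of (c w) = v /\ preorder d (head_of (c w)) (f w)} ->
  preorder d.+1 v (flatten [seq c w :: f w | w <- ws]).
Proof.
elim: ws => [|w ws IH] wsP /=; first exact: preorder_nil.
have [wv dw] := wsP w (mem_head _ _).
rewrite -wv; apply: preorder_cons => //; rewrite wv.
by apply: IH => u uws; apply: wsP; rewrite inE uws orbT.
Qed.

Section Root.
Context (h : nat) (r : V).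
Hypothesis r_height : height_le src dst r h.

Definition level (w : V) : nat :=
  @ex_minn (fun n => within src dst n r w) (ex_intro _ h (r_height w)).

Lemma levelP w : within src dst (level w) r w.
Proof. by rewrite /level; case: ex_minnP. Qed.

Lemma level_le n w : within src dst n r w -> (level w <= n)%N.
Proof. by rewrite /level; case: ex_minnP => m _ + H => /(_ _ H). Qed.

Lemma level_eq0 w : (level w == 0)%N = (w == r).
Proof.
apply/eqP/eqP => [lw|->]; first by have := levelP w; rewrite lw /= => /eqP.
by apply/eqP; rewrite -leqn0; apply: level_le => /=.
Qed.

Lemma parent_edge_exists w : w != r ->
  exists c : E * bool, head_of c == w /\ (level (tail_of c)).+1 == level w.
Proof.
rewrite -level_eq0; case lw: (level w) => [//|n] _.
have := levelP w; rewrite lw /= => /orP[/level_le|/existsP[x /andP[rx /existsP[e exw]]]].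
  by rewrite lw ltnn.
have lx : level x = n.
  apply/eqP; rewrite eqn_leq level_le //= -ltnS -lw; apply: level_le => /=.
  by apply/orP; right; apply/existsP; exists x; rewrite levelP; apply/existsP; exists e.
by case/orP: exw => /andP[/eqP sx /eqP dw]; [exists (e, false)|exists (e, true)];
  rewrite /head_of /tail_of /= ?dw ?sx ?eqxx lx.
Qed.

(** [c0] is a default, returned only at the root, which has no vertex one level above it. *)
Definition parent_edge (c0 : E * bool) (w : V) : E * bool :=
  odflt c0 [pick c | (head_of c == w) && ((level (tail_of c)).+1 == level w)].

Lemma parent_edgeP c0 w : w != r ->
  head_of (parent_edge c0 w) = w /\ (level (tail_of (parent_edge c0 w))).+1 = level w.
Proof.
move=> /parent_edge_exists[c [cw lc]]; rewrite /parent_edge.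
by case: pickP => [c' /andP[/eqP ? /eqP ?] //|/(_ c)]; rewrite cw lc.
Qed.

(** If distinct vertices shared a parent edge, they would traverse it in opposite directions, and
    each would lie one level below the other. *)
Lemma parent_edge_inj c0 u w : u != r -> w != r ->
  (parent_edge c0 u).1 = (parent_edge c0 w).1 -> u = w.
Proof.
move=> /(parent_edgeP c0) + /(parent_edgeP c0).
case: (parent_edge c0 u) (parent_edge c0 w) => [e b] [e' b'] [hu lu] [hw lw] /= ee'.
move: hu lu hw lw; rewrite -{}ee' /head_of /tail_of /=.
by case: b; case: b' => <- lu <- lw //; lia.
Qed.

Definition children (c0 : E * bool) (v : V) : seq V :=
  [seq w <- enum V | (w != r) && (tail_of (parent_edge c0 w) == v)].

Fixpoint dfs_edges (c0 : E * bool) (n : nat) (v : V) : seq (E * bool) :=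
  if n is n'.+1 then
    flatten [seq parent_edge c0 w :: dfs_edges c0 n' w | w <- children c0 v]
  else [::].

Lemma preorder_dfs_edges c0 n v : preorder n v (dfs_edges c0 n v).
Proof.
elim: n v => [|n IH] v /=; first exact: preorder_nil.
apply: preorder_flatten => w; rewrite mem_filter => /andP[/andP[wr /eqP vw] _].
by split=> //; rewrite (proj1 (parent_edgeP c0 wr)).
Qed.

(** The last clause recovers [v] from [c] by climbing a number of levels fixed by [level v]. Hence
    the lists below two distinct children of a vertex are disjoint, which gives uniqueness below. *)
Lemma dfs_edgesP c0 n v c : c \in dfs_edges c0 n v ->
  [/\ head_of c != r, c = parent_edge c0 (head_of c), (level v < level (head_of c))%N &
      v = iter (level (head_of c) - level v) (fun w => tail_of (parent_edge c0 w)) (head_of c)].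
Proof.
elim: n v => [//|n IH] v /= /flatten_mapP[w]; rewrite mem_filter.
case/andP=> /andP[wr /eqP vw] _; have [hw lw] := parent_edgeP c0 wr.
rewrite inE => /orP[/eqP->|/IH[cr cE lc wE]].
  by rewrite hw -lw vw subSnn /=; split.
rewrite -lw vw in lc wE *; split=> //; first exact: ltnW.
by rewrite -subnSK 1?ltnW //= -wE.
Qed.

Lemma uniq_dfs_edges c0 n v : uniq (dfs_edges c0 n v).
Proof.
elim: n v => [//|n IH] v /=.
have chP w : w \in children c0 v ->
    head_of (parent_edge c0 w) = w /\ (level v).+1 = level w.
  by rewrite mem_filter => /andP[/andP[wr /eqP vw] _]; rewrite -[in level v]vw; apply: parent_edgeP.
apply: uniq_flatten_map; first by rewrite filter_uniq // enum_uniq.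
  move=> w /chP[hw lw] /=; rewrite IH andbT; apply/negP => /dfs_edgesP[_ _].
  by rewrite hw ltnn.
have headP w c : w \in children c0 v -> c \in parent_edge c0 w :: dfs_edges c0 n w ->
    w = iter (level (head_of c) - (level v).+1) (fun w => tail_of (parent_edge c0 w)) (head_of c).
  move=> /chP[hw lw]; rewrite inE => /orP[/eqP->|/dfs_edgesP[_ _ _]]; last by rewrite -lw.
  by rewrite hw -lw subnn.
move=> w1 w2 w1v w2v c /(headP _ _ w1v) w1E /(headP _ _ w2v) w2E.
exact: etrans w1E (esym w2E).
Qed.

(** A search started at the root with fuel [h] reaches [u] with fuel [h - level u] left. By
    induction on the level, the list below [u] sits inside the list of the root. *)
Lemma mem_dfs_edges c0 w : w != r -> parent_edge c0 w \in dfs_edges c0 h r.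
Proof.
have level_h u : (level u <= h)%N by exact: level_le (r_height u).
have parent_in v u : u != r -> tail_of (parent_edge c0 u) = v ->
    {subset dfs_edges c0 (h - level v) v <= dfs_edges c0 h r} ->
    {subset parent_edge c0 u :: dfs_edges c0 (h - level u) u <= dfs_edges c0 h r}.
  move=> ur uv sv c cu; apply: sv; have [_ lu] := parent_edgeP c0 ur.
  rewrite uv in lu; rewrite -subnSK ?lu //=.
  by apply/flatten_mapP; exists u => //; rewrite mem_filter ur uv eqxx mem_enum.
have sub k u : level u = k -> {subset dfs_edges c0 (h - level u) u <= dfs_edges c0 h r}.
  elim: k u => [|k IH] u uk.
    by rewrite uk subn0 (_ : u = r) //; apply/eqP; rewrite -level_eq0 uk.
  have ur : u != r by rewrite -level_eq0 uk.
  have [_ lu] := parent_edgeP c0 ur; rewrite uk in lu; case: lu => lu.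
  by move=> c cu; apply: (parent_in _ u ur erefl (IH _ lu)); rewrite inE cu orbT.
by move=> wr; apply: (parent_in _ w wr erefl (sub _ _ erefl)); rewrite mem_head.
Qed.

End Root.

(** The parent edges of the vertices other than the root are pairwise distinct, and a tree has
    exactly as many edges as such vertices, so every edge is a parent edge and is listed. *)
Lemma preorder_exists h r : is_tree src dst -> height_le src dst r h -> E ->
  exists s : seq (E * bool), [/\ preorder h r s, uniq (unzip1 s) & forall e, e \in unzip1 s].
Proof.
move=> [_ cardE] rh e0; pose pe := parent_edge rh (e0, false).
exists (dfs_edges rh (e0, false) h r); split.
- exact: preorder_dfs_edges.
- rewrite map_inj_in_uniq ?uniq_dfs_edges // => c c' /dfs_edgesP[cr -> _ _] /dfs_edgesP[cr' -> _ _].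
  by move=> /(parent_edge_inj cr cr') ->.
- pose A : {set E} := (fun w => (pe w).1) @: predC1 r.
  suff AT : A = finset.setT.
    move=> e; have : e \in A by rewrite AT finset.in_setT.
    by case/imsetP => w wr ->; apply: map_f; apply: mem_dfs_edges.
  apply/eqP; rewrite eqEcard finset.subsetT /= card_in_imset ?finset.cardsT; last first.
    by move=> u w ur wr; apply: parent_edge_inj.
  by rewrite cardC1 -cardE.
Qed.

End Preorder.

(** * Arcs of the concatenated edges and their connected pieces *)

Section Arcs.
Context {R : realType} {V E : finType} (src dst : E -> V).
Implicit Types (c : E * bool) (s : seq (E * bool)) (x y z : R) (P Q : piece R E).

Local Notation tail_of := (tail_of src dst).
Local Notation head_of := (head_of src dst).
Local Notation vertex_of := (vertex_of src dst).
Local Notation conn := (conn src dst).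

(** Converts between the stored coordinate of an edge and the one that grows in the direction of
    travel. *)
Definition orient (b : bool) z : R := if b then 1 - z else z.

Definition point c z : E * R := (c.1, orient c.2 z).

Definition clip c x y : piece R E :=
  let a := Num.max 0 x in let b := Num.min 1 y in
  if a <= b then [:: (c.1, if c.2 then 1 - b else a, if c.2 then 1 - a else b)]
  else [::].

(* The concatenation of the edges of [s], each of length 1, is identified with
   [0, size s]; [arc s x y] is the part of it lying between x and y. *)
Fixpoint arc s x y : piece R E :=
  if s is c :: s' then clip c x y ++ arc s' (x - 1) (y - 1) else [::].

(** Inverse to the parametrization behind [arc]: the abscissa in [0, size s] of a point given by its
    edge and stored coordinate. The base value 0 is reached only for edges missing from [s]. *)
Fixpoint pos s (e : E) z : R :=
  if s is c :: s' then if c.1 == e then orient c.2 z else 1 + pos s' e z else 0.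

Lemma orientK b : involutive (orient b).
Proof. by case: b => z; rewrite /orient //; ring. Qed.

Lemma orient01 b z : 0 <= z <= 1 -> 0 <= orient b z <= 1.
Proof. by case: b; rewrite /orient //; lra. Qed.

Lemma pset_cat P Q e : pset (P ++ Q) e = pset P e `|` pset Q e.
Proof.
apply/seteqP; split=> z /=.
  by move=> [i]; rewrite mem_cat => /orP[]iP [<- iz]; [left|right]; exists i.
by move=> [] [i iP iz]; exists i => //; rewrite mem_cat iP ?orbT.
Qed.

Lemma pset_nil (e : E) : pset ([::] : piece R E) e = set0.
Proof. by apply/seteqP; split=> z //= -[]. Qed.

Lemma clipP c x y e z :
  pset (clip c x y) e z <-> [/\ c.1 = e, 0 <= z <= 1 & x <= orient c.2 z <= y].
Proof.
rewrite /clip /orient; split.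
  case: ifP => [ab|_ []//] [i]; rewrite inE => /eqP -> /= [<-]; move: ab.
  by case: c.2; rewrite /Num.max /Num.min; case: ifP; case: ifP => *; split=> //; lra.
move=> [<- z01 xzy].
have ab : Num.max 0 x <= Num.min 1 y.
  move: z01 xzy.
  by case: c.2; rewrite /Num.max /Num.min; case: ifP; case: ifP => *; lra.
rewrite ab; eexists; first exact: mem_head.
split=> //=; move: z01 xzy.
by case: c.2; rewrite /Num.max /Num.min; case: ifP; case: ifP => *; lra.
Qed.

Lemma arc_cat s1 s2 x y :
  arc (s1 ++ s2) x y = arc s1 x y ++ arc s2 (x - (size s1)%:R) (y - (size s1)%:R).
Proof.
elim: s1 x y => [|c s1 IH] x y /=; first by rewrite !subr0.
by rewrite IH -catA -!addrA -!opprD -mulrS.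
Qed.

Lemma wf_clip c x y : wf_piece (clip c x y).
Proof.
rewrite /clip => i; case: ifP => // ab; rewrite inE => /eqP -> /=; move: ab.
by case: c.2; rewrite /Num.max /Num.min; case: ifP; case: ifP => *; lra.
Qed.

Lemma wf_cat P Q : wf_piece P -> wf_piece Q -> wf_piece (P ++ Q).
Proof. by move=> wP wQ i; rewrite mem_cat => /orP[/wP|/wQ]. Qed.

Lemma wf_arc s x y : wf_piece (arc s x y).
Proof.
elim: s x y => [|c s IH] x y //=.
by apply: wf_cat; [exact: wf_clip|exact: IH].
Qed.

Lemma arc_bounds s x y e z :
  pset (arc s x y) e z -> [/\ 0 <= y, x <= (size s)%:R & 0 <= z <= 1].
Proof.
elim: s x y => [|c s IH] x y /=; first by rewrite pset_nil.
rewrite pset_cat => -[/clipP[_ z01 xzy]|/IH[y1 xs ?]].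
  have := orient01 c.2 z01; rewrite mulrS; have := ler0n R (size s).
  by move=> *; split; lra.
by rewrite mulrS; split; lra.
Qed.

Lemma conn_trans P : forall p q r, conn P p q -> conn P q r -> conn P p r.
Proof. by move=> p q r; elim=> // {}p p' {}q pp' _ IH /IH; apply: conn_step. Qed.

Lemma conn1 P p q : step src dst P p q -> conn P p q.
Proof. by move=> pq; apply: conn_step pq (conn_refl _ _ _ _). Qed.

Lemma same_pt_sym (p q : E * R) : same_pt src dst p q -> same_pt src dst q p.
Proof. by case=> [->|[v [pv qv]]]; [left|right; exists v]. Qed.

Lemma pset_inP P p : pset P p.1 p.2 -> inP src dst P p.
Proof. by exists p; split=> //; left. Qed.

Lemma conn_vertex P (v : V) (p q : E * R) : vertex_of p = Some v ->
  vertex_of q = Some v -> pset P q.1 q.2 -> conn P p q.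
Proof.
move=> pv qv qP; apply: conn1; left; have pq : same_pt src dst p q by right; exists v.
by split=> //; exists q.
Qed.

Lemma conn_point P c x y : x <= y ->
  (forall z, x <= z <= y -> pset P c.1 (orient c.2 z)) ->
  conn P (point c x) (point c y).
Proof.
move=> xy xyP; apply: conn1; right; split=> // z zxy.
apply: pset_inP => /=; rewrite -(orientK c.2 z); apply: xyP.
by move: zxy; rewrite /point /orient /Num.min /Num.max /=; case: c.2; case: ifP => *; lra.
Qed.

Lemma vertex_point0 c : vertex_of (point c 0) = Some (tail_of c).
Proof.
by rewrite /Defs.vertex_of /point /orient /tail_of; case: c.2; rewrite /= ?subr0 ?oner_eq0 eqxx.
Qed.

Lemma vertex_point1 c : vertex_of (point c 1) = Some (head_of c).
Proof.
by rewrite /Defs.vertex_of /point /orient /head_of; case: c.2; rewrite /= ?subrr ?oner_eq0 eqxx.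
Qed.

(** A vertex has one representative for each edge end glued to it; quantifying over all of them
    avoids a choice. *)
Definition reaches P (v : V) (p : E * R) :=
  forall q, vertex_of q = Some v -> conn P q p.

(** An arc that starts before the list and meets [s1] contains the whole edge [c], so one travels
    along [c] and continues from its head; [s2] hangs from [v] itself. Paths are taken in a larger
    piece [P] so that the result also applies to a union of two arcs. *)
Lemma initial_arc_reaches P d v s x y : preorder src dst d v s -> x <= 0 ->
  (forall e, pset (arc s x y) e `<=` pset P e) ->
  forall e z, pset (arc s x y) e z -> reaches P v (e, z).
Proof.
move=> H; elim: H x y => {d v s} [d v|d c s1 s2 _ IH1 _ IH2] x y x0 sub e z /=.
  by rewrite pset_nil.
have start u : 0 <= u <= 1 -> u <= y -> reaches P (tail_of c) (point c u).
  move=> u01 uy q qv.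
  have inc z' : 0 <= z' <= u -> pset P c.1 (orient c.2 z').
    move=> z'u; apply: sub => /=; rewrite pset_cat; left; apply/clipP.
    by rewrite orientK; split=> //; [apply: orient01; lra|lra].
  apply: (@conn_trans _ _ (point c 0)).
    by apply: conn_vertex qv (vertex_point0 c) _; apply: inc; lra.
  by apply: conn_point; [lra|exact: inc].
move: sub => /=; rewrite arc_cat => sub.
rewrite !pset_cat => -[/clipP[<- z01 xzy]|[zs1|zs2]].
- have -> : (c.1, z) = point c (orient c.2 z) by rewrite /point orientK.
  by apply: start; [exact: orient01|lra].
- have [y1 _ _] := arc_bounds zs1.
  move=> q qv; apply: (@conn_trans _ _ (point c 1)); first by apply: start qv; lra.
  apply: IH1 zs1 _ (vertex_point1 c); first by lra.
  by move=> e' z' z's1; apply: sub; rewrite !pset_cat; right; left.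
- apply: IH2 zs2; first by have := ler0n R (size s1); lra.
  by move=> e' z' z's2; apply: sub; rewrite !pset_cat; right; right.
Qed.

(** Induction on where the arc starts. Entering [s1] costs one representative, for the head of [c],
    and lowers the depth by one; moving on to [s2] costs nothing and keeps the depth. Whatever comes
    after the sublist in which the arc starts is initial there and joins its own root. *)
Lemma arc_representatives P d v s x y : preorder src dst d v s ->
  (forall e, pset (arc s x y) e `<=` pset P e) ->
  exists2 reps : seq (E * R), (size reps <= d)%N &
    forall e z, pset (arc s x y) e z ->
      (exists2 r, r \in reps & conn P r (e, z)) \/ reaches P v (e, z).
Proof.
move=> H; elim: (H) x y => {d v s H} [d v|d c s1 s2 H1 IH1 H2 IH2] x y sub.
  by exists [::] => // e z /=; rewrite pset_nil.
have [x0|x0] := lerP x 0.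
  exists [::] => // e z zs; right.
  exact: initial_arc_reaches (preorder_cons H1 H2) x0 sub _ _ zs.
move: sub => /=; rewrite arc_cat => sub.
have sub1 e : pset (arc s1 (x - 1) (y - 1)) e `<=` pset P e.
  by move=> z zs; apply: sub; rewrite !pset_cat; right; left.
have sub2 e : pset (arc s2 (x - 1 - (size s1)%:R) (y - 1 - (size s1)%:R)) e `<=` pset P e.
  by move=> z zs; apply: sub; rewrite !pset_cat; right; right.
have s1_ge0 := ler0n R (size s1).
have [x1|x1] := lerP x 1.
  (* The arc starts on [c]: the rest of [c] and all of the arc in [s1] hang together from the
     starting point. *)
  exists [:: point c x] => // e z; rewrite !pset_cat.
  have inc u : u <= y -> forall z', x <= z' <= u -> u <= 1 -> pset P c.1 (orient c.2 z').
    move=> uy z' xz'u u1; apply: sub => /=; rewrite pset_cat; left; apply/clipP.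
    by rewrite orientK; split=> //; [apply: orient01; lra|lra].
  have start u : x <= u <= 1 -> u <= y -> conn P (point c x) (point c u).
    by move=> xu uy; apply: conn_point => [|z' ?]; [lra|apply: (inc u) => //; lra].
  move=> [/clipP[<- z01 xzy]|[zs1|zs2]].
  - left; exists (point c x); first exact: mem_head.
    have -> : (c.1, z) = point c (orient c.2 z) by rewrite /point orientK.
    by apply: start; [have := orient01 c.2 z01; lra|lra].
  - left; exists (point c x); first exact: mem_head.
    have [y1 _ _] := arc_bounds zs1.
    apply: (@conn_trans _ _ (point c 1)); first by apply: start; lra.
    by apply: initial_arc_reaches H1 _ sub1 _ _ zs1 _ (vertex_point1 c); lra.
  - by right; apply: initial_arc_reaches H2 _ sub2 _ _ zs2; lra.
have noclip e z : ~ pset (clip c x y) e z.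
  by move=> /clipP[_ z01 xzy]; have := orient01 c.2 z01; lra.
have [x2|x2] := lerP (x - 1) (size s1)%:R.
  have [reps reps_d repsP] := IH1 _ _ sub1.
  (* The arc starts inside [s1]: the edge [c] is cut off, so the part joined to its head needs a
     representative of its own. *)
  exists (point c 1 :: reps) => // e z; rewrite !pset_cat => -[/noclip //|[zs1|zs2]].
    left; have [[r rr rz]|vz] := repsP _ _ zs1; first by exists r; rewrite // inE rr orbT.
    by exists (point c 1); [exact: mem_head|exact: vz (vertex_point1 c)].
  by right; apply: initial_arc_reaches H2 _ sub2 _ _ zs2; lra.
have [reps reps_d repsP] := IH2 _ _ sub2.
exists reps => // e z; rewrite !pset_cat => -[/noclip //|[/arc_bounds[_ ? _]|]]; first by lra.
exact: repsP.
Qed.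

Lemma at_most_components_reps P k (reps : seq (E * R)) : (size reps <= k)%N ->
  (forall e z, pset P e z -> exists2 r, r \in reps & conn P r (e, z)) ->
  at_most_components src dst P k.
Proof.
move=> repsk repsP; exists reps; split=> // p _ [[e z] [pq /= qP]].
have [r rr rq] := repsP _ _ qP; exists r => //.
apply: conn_trans rq _; apply: conn1; left; split; first exact: same_pt_sym.
exact: pset_inP.
Qed.

Lemma pset_arc_mem s x y e z : pset (arc s x y) e z -> e \in unzip1 s.
Proof.
elim: s x y => [|c s IH] x y /=; first by rewrite pset_nil.
by rewrite pset_cat inE => -[/clipP[-> _ _]|/IH ->]; rewrite ?eqxx ?orbT.
Qed.

Lemma pset_arcP s x y e z : uniq (unzip1 s) -> e \in unzip1 s ->
  pset (arc s x y) e z <-> 0 <= z <= 1 /\ x <= pos s e z <= y.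
Proof.
elim: s x y => [//|c s IH] x y /= /andP[cs us].
rewrite inE eq_sym pset_cat; have [ce _|ce /= es] := eqVneq c.1 e.
  split=> [[/clipP[]//|]|[z01 xzy]]; last by left; apply/clipP.
  by move=> /pset_arc_mem; rewrite -ce (negPf cs).
split.
  by move=> [/clipP[ce']|]; [rewrite ce' eqxx in ce|case/(IH _ _ us es) => *; lra].
by move=> [z01 xzy]; right; apply/(IH _ _ us es); lra.
Qed.

Lemma pos_bounds s e z : e \in unzip1 s -> 0 <= z <= 1 -> 0 <= pos s e z <= (size s)%:R.
Proof.
move=> + z01; elim: s => [//|c s IH] /=; rewrite inE eq_sym mulrS.
have := ler0n R (size s); have := orient01 c.2 z01.
by have [_ ? ? _|_ _ _ /= /IH] := eqVneq c.1 e; lra.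
Qed.

Lemma pos_inj s e : e \in unzip1 s -> injective (pos s e).
Proof.
elim: s => [//|c s IH] /=; rewrite inE eq_sym.
have [_ _ z z'|_ /= /IH inj z z' /addrI] := eqVneq c.1 e; last exact: inj.
exact: (inv_inj (orientK c.2)).
Qed.

End Arcs.

(** * Chords of continuous functions and common increments *)

Lemma continuous_gt0_of_nonzero {R : realType} (f : R -> R) (a b w : R) : continuous f ->
  (forall u, a <= u <= b -> f u != 0) -> a <= w <= b -> 0 < f w ->
  forall u, a <= u <= b -> 0 < f u.
Proof.
move=> cf f_neq0 awb fw0 u aub; rewrite ltNge; apply/negP => fu0.
have noroot v : a <= v <= b -> f v <> 0 by move=> /f_neq0 /eqP.
have [wu|uw] := lerP w u.
  have [||v] := @IVT R f w u 0 wu; first exact: continuous_subspaceT.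
    by rewrite ge_min fu0 orbT le_max (ltW fw0).
  by rewrite in_itv /= => wvu; apply: noroot; lra.
have [||v] := @IVT R f u w 0 (ltW uw); first exact: continuous_subspaceT.
  by rewrite ge_min fu0 le_max (ltW fw0) orbT.
by rewrite in_itv /= => uvw; apply: noroot; lra.
Qed.

Lemma continuous_shift {R : realType} (f : R -> R) (d : R) :
  continuous f -> continuous (fun u => f (u + d)).
Proof.
move=> cf u; apply: (@continuous_comp _ _ _ (fun u => u + d) f); last exact: cf.
by apply: cvgD; [exact: cvg_id|exact: cvg_cst].
Qed.

Lemma continuous_reflect {R : realType} (f : R -> R) (d : R) :
  continuous f -> continuous (fun u => f (d - u)).
Proof.
move=> cf u; apply: (@continuous_comp _ _ _ (fun u => d - u) f); last exact: cf.
by apply: cvgB; [exact: cvg_cst|exact: cvg_id].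
Qed.

Lemma continuous_increment {R : realType} (f : R -> R) (d : R) :
  continuous f -> continuous (fun u => f (u + d) - f u).
Proof. by move=> cf u; apply: cvgB; [exact: continuous_shift|exact: cf]. Qed.

Lemma no_chord_contradiction {R : realType} (D : R -> R) (t : R) : continuous D ->
  D 0 = D 1 -> 0 <= t <= 1 -> D 0 < D t ->
  (forall u, 0 <= u <= 1 - t -> D (u + t) != D u) ->
  (forall u, 0 <= u <= t -> D (u + (1 - t)) != D u) -> False.
Proof.
move=> cD D01 t01 D0t no_t no_1t.
(* A nonvanishing continuous increment keeps its sign, which is read off here at [u = 0]. *)
have up u : 0 <= u <= 1 - t -> D u < D (u + t).
  move=> u0; rewrite -subr_gt0.
  apply: (@continuous_gt0_of_nonzero _ (fun u => D (u + t) - D u) 0 (1 - t) 0) => //.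
  - exact: continuous_increment.
  - by move=> v v0; rewrite subr_eq0; exact: no_t.
  - by lra.
  - by rewrite add0r subr_gt0.
(* Here the sign is read off at [u = t], where the increment is [D 1 - D t = D 0 - D t]. *)
have down u : 0 <= u <= t -> D (u + (1 - t)) < D u.
  move=> u0; rewrite -subr_gt0 -opprB.
  apply: (@continuous_gt0_of_nonzero _ (fun u => - (D (u + (1 - t)) - D u)) 0 t t) => //.
  - by move=> v; apply: cvgN; exact: continuous_increment.
  - by move=> v v0; rewrite oppr_eq0 subr_eq0; exact: no_1t.
  - by lra.
  - by rewrite opprB subr_gt0 addrC subrK -D01.
have [|c] := @EVT_max R D 0 1 ler01; first exact: continuous_subspaceT.
rewrite in_itv /= => c01 cmax.
have {}cmax v : 0 <= v <= 1 -> D v <= D c by move=> v01; apply: cmax; rewrite in_itv.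
have [ct|ct] := lerP c (1 - t).
  have : D c < D (c + t) by apply: up; lra.
  by rewrite ltNge cmax //; lra.
have := down (c - (1 - t)); rewrite subrK => Dc.
have : D c < D (c - (1 - t)) by apply: Dc; lra.
by rewrite ltNge cmax //; lra.
Qed.

(* At a maximum of [D] a chord of span [t] leaving it goes down, and one
   arriving at it goes up; periodicity turns the chords that leave [0, 1] into
   chords of span [1 - t]. *)
Lemma chord_or_complementary_chord {R : realType} (D : R -> R) (t : R) : continuous D ->
  D 0 = D 1 -> 0 <= t <= 1 ->
  (exists2 u, 0 <= u <= 1 - t & D (u + t) = D u) \/
  (exists2 u, 0 <= u <= t & D (u + (1 - t)) = D u).
Proof.
move=> cD D01 t01; have [?|no_t] := pselect (exists2 u, 0 <= u <= 1 - t & D (u + t) = D u).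
  by left.
have [?|no_1t] := pselect (exists2 u, 0 <= u <= t & D (u + (1 - t)) = D u); first by right.
have {}no_t u : 0 <= u <= 1 - t -> D (u + t) != D u.
  by move=> u0; apply/eqP => Du; apply: no_t; exists u.
have {}no_1t u : 0 <= u <= t -> D (u + (1 - t)) != D u.
  by move=> u0; apply/eqP => Du; apply: no_1t; exists u.
exfalso; case: (ltgtP (D 0) (D t)) => D0t.
- exact: (no_chord_contradiction cD D01 t01 D0t).
- apply: (@no_chord_contradiction _ (fun u => - D u) t) => //.
  + by move=> u; apply: cvgN; exact: cD.
  + by rewrite D01.
  + by rewrite ltrN2.
  + by move=> u /no_t; rewrite eqr_opp.
  + by move=> u /no_1t; rewrite eqr_opp.
- by have := no_t 0; rewrite add0r D0t eqxx => H; have : false by apply: H; lra.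
Qed.

(** The constant 2 is the one produced by reparametrizing by the half-sum of two monotone
    functions. *)
Lemma lipschitz2_continuous {R : realType} (f : R -> R) :
  (forall u v, `|f u - f v| <= 2 * `|u - v|) -> continuous f.
Proof.
move=> lip u; apply/cvgrPdist_lt => e e0; near=> v.
apply: le_lt_trans (lip u v) _.
rewrite mulrC -ltr_pdivlMr //.
near: v; apply: cvgr_dist_lt; [exact: cvg_id|exact: divr_gt0].
Unshelve. all: end_near. Qed.

(* Parametrizing by M = (F + G) / 2 makes F a Lipschitz function f of M, even
   where F or G is constant; an arc of M-measure t on which F grows by t then
   has G grow by t as well. *)
Lemma common_increment {R : realType} (F G : R -> R) (a b t : R) : a <= b ->
  continuous F -> continuous G ->
  {homo F : x y / x <= y} -> {homo G : x y / x <= y} ->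
  F a = 0 -> G a = 0 -> F b = 1 -> G b = 1 -> 0 <= t <= 1 ->
  exists x y, [/\ a <= x, x <= y, y <= b &
    (F y - F x = t /\ G y - G x = t) \/ (F y - F x = 1 - t /\ G y - G x = 1 - t)].
Proof.
move=> ab cF cG hF hG Fa Ga Fb Gb t01; pose M x := (F x + G x) / 2.
have cM : continuous M.
  by move=> x; apply: cvgM; [apply: cvgD; [exact: cF|exact: cG]|exact: cvg_cst].
(* Clamping extends the reparametrized function to the whole line, where the chord lemma asks for
   continuity. *)
pose clamp u : R := Num.max 0 (Num.min 1 u).
have clampP u : [\/ u <= 0 /\ clamp u = 0, 0 <= u <= 1 /\ clamp u = u | 1 <= u /\ clamp u = 1].
  rewrite /clamp; have [u0|u0] := lerP u 0.
    by apply: Or31; rewrite min_r ?max_l //; lra.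
  have [u1|u1] := lerP u 1; first by apply: Or32; rewrite max_r; lra.
  by apply: Or33; rewrite max_r; lra.
have gex u : exists x, a <= x <= b /\ M x = clamp u.
  have [||x] := @IVT R M a b (clamp u) ab; first exact: continuous_subspaceT.
  - have -> : M a = 0 by rewrite /M Fa Ga; lra.
    have -> : M b = 1 by rewrite /M Fb Gb; lra.
    by rewrite min_l ?max_r //; case: (clampP u) => -[? ->]; lra.
  - by rewrite in_itv /= => xab Mx; exists x.
(* [g] is an arbitrary section of [M] and may jump where [M] is constant; only [F] composed with [g]
   is shown to be continuous. *)
have [g gP] := choice gex.
pose f u := F (g u).
have FM x y : `|F x - F y| <= 2 * `|M x - M y|.
  wlog xy : x y / x <= y => [H|].
    by have [/H//|/ltW/H] := lerP x y; rewrite (distrC (F y)) (distrC (M y)).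
  rewrite (distrC (F x)) (distrC (M x)) /M; have := hF _ _ xy; have := hG _ _ xy => *.
  by rewrite !ger0_norm; lra.
have clampE u : 0 <= u <= 1 -> clamp u = u.
  by case: (clampP u) => -[? ->]; lra.
have lipf u v : `|f u - f v| <= 2 * `|u - v|.
  apply: le_trans (FM _ _) _; rewrite ler_pM2l // (proj2 (gP u)) (proj2 (gP v)).
  have := ler_norm (u - v); have := ler_norm (v - u); rewrite (distrC v u) ler_norml.
  by case: (clampP u) => -[? ->]; case: (clampP v) => -[? ->]; lra.
have f_of_M x : a <= x <= b -> f (M x) = F x.
  move=> xab; apply/eqP; rewrite -subr_eq0 -normr_le0.
  apply: le_trans (FM _ _) _; rewrite (proj2 (gP _)) clampE ?subrr ?normr0 ?mulr0 //.
  have [ax xb] : a <= x /\ x <= b by lra.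
  have := hF _ _ ax; have := hF _ _ xb; have := hG _ _ ax; have := hG _ _ xb.
  by rewrite /M Fa Ga Fb Gb; lra.
have f0 : f 0 = 0 by rewrite -[in f 0](_ : M a = 0) ?f_of_M ?lexx //= /M Fa Ga; ring.
have f1 : f 1 = 1 by rewrite -[in f 1](_ : M b = 1) ?f_of_M ?lexx ?ab //= /M Fb Gb; field.
(* A horizontal chord of [f u - u] makes both [M] and [F] grow by [d], hence also [G = 2 M - F]. *)
have arcs u d : 0 <= d -> 0 <= u <= 1 - d -> f (u + d) - (u + d) = f u - u ->
    exists x y, [/\ a <= x, x <= y, y <= b & F y - F x = d /\ G y - G x = d].
  move=> d0 u0 fu; have [xab Mx] := gP u; have [yab My] := gP (u + d).
  rewrite clampE in Mx; last by lra.
  rewrite clampE in My; last by lra.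
  have [xy|yx] := lerP (g u) (g (u + d)).
    exists (g u), (g (u + d)); split; try lra.
    by move: fu Mx My; rewrite /f /M; lra.
  (* If [g] reverses the order, monotonicity of [F] forces [d = 0], and a degenerate arc works. *)
  exists (g u), (g u); split; try lra.
  have := hF _ _ (ltW yx); have := hG _ _ (ltW yx); move: fu Mx My.
  by rewrite /f /M; lra.
have cD : continuous (fun u => f u - u).
  by move=> u; apply: cvgB; [exact: lipschitz2_continuous|exact: cvg_id].
have [|[u u0 fu]|[u u0 fu]] := @chord_or_complementary_chord _ _ t cD _ t01.
- by rewrite f0 f1; ring.
- have [||x [y [ax xy yb xyt]]] := arcs u t _ _ fu; [lra|lra|].
  by exists x, y; split=> //; left.
- have [||x [y [ax xy yb xyt]]] := arcs u (1 - t) _ _ fu; [lra|lra|].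
  by exists x, y; split=> //; right.
Qed.

(** * Distribution functions of finite atomless measures *)

Section Mass.
Context {R : realType} (mu : {measure set R -> \bar R}).
Hypothesis mu_fin : (mu setT < +oo)%E.
Hypothesis mu_atomless : forall x, mu [set x] = 0%E.

Definition mass (z : R) : R := fine (mu `]-oo, z]%classic).

Lemma measure_fin_num A : measurable A -> mu A \is a fin_num.
Proof.
move=> mA; rewrite ge0_fin_numE ?measure_ge0 //; apply: le_lt_trans mu_fin.
by apply: le_measure => //; rewrite inE.
Qed.

Lemma massE z : mu `]-oo, z]%classic = (mass z)%:E.
Proof. by rewrite fineK // measure_fin_num. Qed.

Lemma measure_itv_mass x y : x <= y -> mu `[x, y]%classic = (mass y - mass x)%:E.
Proof.
move=> xy; rewrite EFinB -!massE.
have -> : `]-oo, y]%classic = `]-oo, x]%classic `|` `[x, y]%classic.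
  apply/seteqP; split=> z /=; rewrite !in_itv /=; last by case; lra.
  by move=> zy; have [zx|xz] := lerP z x; [left|right; lra].
rewrite measureUfinl //; last by rewrite massE ltry.
have -> : `]-oo, x]%classic `&` `[x, y]%classic = [set x].
  apply/seteqP; split=> z /=; rewrite !in_itv /=.
    by move=> [? ?]; apply/eqP; rewrite eq_le; lra.
  by move=> ->; rewrite lexx.
by rewrite mu_atomless sube0 addeAC massE subee // add0e.
Qed.

Lemma mass_homo : {homo mass : x y / x <= y}.
Proof.
move=> x y xy; rewrite -subr_ge0 -lee_fin -measure_itv_mass //.
Qed.

(** Closed intervals shrinking to [z] have measures tending to that of the point, which is 0.
    Monotonicity of [mass] then squeezes its variation near [z]. *)
Lemma mass_continuous : continuous mass.
Proof.
move=> z; apply/cvgrPdist_lt => e e0.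
pose I n : set R := `[z - n.+1%:R^-1, z + n.+1%:R^-1]%classic.
have capI : \bigcap_n I n = [set z].
  apply/seteqP; split=> [y Iy|y -> n _] /=; last first.
    by rewrite /I /= in_itv /= gerBl lerDl invr_ge0 ler0n.
  apply/eqP; rewrite -subr_eq0 -normr_le0 leNgt; apply/negP => yz0.
  have [n _ /(_ _ (leqnn n)) nyz] := near_infty_natSinv_lt (PosNum yz0).
  have := Iy n Logic.I; rewrite /I /= in_itv /=; move: nyz => /=.
  move: (n.+1%:R^-1) => d nyz yI; move: nyz.
  by rewrite ltNge ler_norml => /negP; apply; lra.
have mI n : measurable (I n) by exact: measurable_itv.
have : (mu \o I) n @[n --> \oo] --> mu (\bigcap_n I n).
  apply: nonincreasing_cvg_mu => //.
  - by rewrite -ge0_fin_numE ?measure_ge0 // measure_fin_num.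
  - by rewrite capI.
  - move=> m n mn; apply/subsetPset => y; rewrite /I /= !in_itv /=.
    have : n.+1%:R^-1 <= m.+1%:R^-1 :> R by rewrite lef_pV2 ?posrE // ler_nat.
    by move: (n.+1%:R^-1) (m.+1%:R^-1) => d d'; lra.
rewrite capI mu_atomless => /fine_cvgP[_] /cvgrPdist_lt /(_ _ e0) [n _ /(_ _ (leqnn n)) /=].
have : 0 < n.+1%:R^-1 :> R by [].
rewrite /I; move: (n.+1%:R^-1) => d d_gt0.
rewrite measure_itv_mass /=; last by lra.
rewrite sub0r normrN => mass_lt; near=> y.
have : `|z - y| < d by near: y; apply: cvgr_dist_lt; [exact: cvg_id|].
rewrite ltr_norml => zy.
have h1 : mass (z - d) <= mass y by apply: mass_homo; lra.
have h2 : mass y <= mass (z + d) by apply: mass_homo; lra.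
have h3 : mass (z - d) <= mass z by apply: mass_homo; lra.
have h4 : mass z <= mass (z + d) by apply: mass_homo; lra.
have := ler_norm (mass (z + d) - mass (z - d)).
by rewrite ltr_norml; lra.
Unshelve. all: end_near. Qed.

End Mass.

(** * Values of arcs as increments of one function *)

Section Values.
Context {R : realType} {V E : finType} (src dst : E -> V).
Implicit Types (c : E * bool) (s : seq (E * bool)) (x y z : R) (P Q : piece R E).

Lemma measurable_pset P e : measurable (pset P e).
Proof.
elim: P => [|i P IH]; first by rewrite pset_nil.
rewrite -cat1s pset_cat; apply: measurableU => //.
have [ie|ie] := eqVneq i.1.1 e.
  have -> : pset [:: i] e = `[i.1.2, i.2]%classic.
    apply/seteqP; split=> z /=; rewrite in_itv /=.
      by move=> [j]; rewrite inE => /eqP -> [].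
    by exists i; rewrite ?inE.
  by [].
have -> : pset [:: i] e = set0; last by [].
apply/seteqP; split=> z //= [j]; rewrite inE => /eqP -> [ie'].
by rewrite ie' eqxx in ie.
Qed.

Section Valuation.
Context (mu : E -> {measure set R -> \bar R}).
Hypothesis muV : valuation mu.

Lemma valuation_outside e : mu e [set x | x < 0 \/ 1 < x] = 0%E.
Proof. by case: muV. Qed.

Lemma valuation_atomless e x : mu e [set x] = 0%E.
Proof. by case: muV => _ []. Qed.

Lemma measurable_outside : measurable [set x : R | x < 0 \/ 1 < x].
Proof.
have -> : [set x : R | x < 0 \/ 1 < x] = `]-oo, 0[%classic `|` `]1, +oo[%classic.
  by apply/seteqP; split=> x /=; rewrite !in_itv /= andbT.
exact: measurableU.
Qed.

(** Lets distribution functions on the whole line compute the value of arcs truncated to an edge. *)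
Lemma valuation_inside e (A : set R) : measurable A -> mu e (A `&` `[0, 1]%classic) = mu e A.
Proof.
move=> mA; rewrite -[in RHS](setUIDK A `[0, 1]%classic) measureU //.
- rewrite -[LHS]adde0; congr (_ + _)%E; apply/esym.
  apply: (@subset_measure0 _ _ _ (mu e) _ [set x | x < 0 \/ 1 < x]).
  + exact: measurableD.
  + exact: measurable_outside.
  + move=> x /= [_ /negP]; rewrite in_itv /= negb_and -!ltNge => /orP[];
    by [left|right].
  + exact: valuation_outside.
- exact: measurableI.
- exact: measurableD.
- by apply/seteqP; split=> x //= -[[_ xI] [_]].
Qed.

Lemma valuation_fin e : (mu e setT < +oo)%E.
Proof.
rewrite -valuation_inside // setTI; case: muV => _ [_ tot].
apply: (@le_lt_trans _ _ 1%E); last exact: ltry.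
rewrite -tot (bigD1 e) //= set_itvcc leeDl // sume_ge0 //.
Qed.

(** A distribution function along the direction of travel, up to an additive constant; only its
    increments matter. *)
Definition edge_mass c z : R := if c.2 then - mass (mu c.1) (1 - z) else mass (mu c.1) z.

Fixpoint arc_mass s x : R :=
  if s is c :: s' then edge_mass c x + arc_mass s' (x - 1) else 0.

Lemma arc_mass_homo s : {homo arc_mass s : x y / x <= y}.
Proof.
elim: s => [|c s IH] x y xy //=; apply: lerD; last by apply: IH; lra.
rewrite /edge_mass; case: c.2; first rewrite lerN2.
- by apply: mass_homo; [exact: valuation_fin|exact: valuation_atomless|lra].
- by apply: mass_homo; [exact: valuation_fin|exact: valuation_atomless|].
Qed.

Lemma arc_mass_continuous s : continuous (arc_mass s).
Proof.
have cmass e := mass_continuous (valuation_fin e) (valuation_atomless e).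
elim: s => [|c s IH]; first by move=> x; exact: cvg_cst.
move=> x; apply: cvgD; last exact: (continuous_shift IH).
rewrite /edge_mass; case: c.2; last exact: cmass.
by apply: cvgN; exact: (continuous_reflect (cmass _)).
Qed.

Lemma value_cat P Q : (forall e, mu e (pset P e `&` pset Q e) = 0%E) ->
  value mu (P ++ Q) = (value mu P + value mu Q)%E.
Proof.
move=> PQ0; rewrite /value -big_split /=; apply: eq_bigr => e _.
rewrite pset_cat measureUfinl ?PQ0 ?sube0 //; try exact: measurable_pset.
rewrite -ge0_fin_numE ?measure_ge0 //; apply: measure_fin_num (valuation_fin e) _ _.
exact: measurable_pset.
Qed.

Lemma value_clip c x y : x <= y ->
  value mu (clip c x y) = (edge_mass c y - edge_mass c x)%:E.
Proof.
move=> xy; rewrite /value (bigD1 c.1) //= big1 ?adde0 => [|e ec]; last first.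
  rewrite (_ : pset _ _ = set0) //; apply/seteqP; split=> z // /clipP[ce].
  by rewrite ce eqxx in ec.
have [fin atomless] := (valuation_fin c.1, valuation_atomless c.1).
have -> : pset (clip c x y) c.1 =
    (if c.2 then `[1 - y, 1 - x]%classic else `[x, y]%classic) `&` `[0, 1]%classic.
  apply/seteqP; split=> z.
    by move=> /clipP[_]; rewrite /orient; case: c.2 => /=; rewrite !in_itv /=; lra.
  move=> zxy; apply/clipP; split=> //; move: zxy;
  by rewrite /orient; case: c.2 => /=; rewrite !in_itv /=; lra.
rewrite /edge_mass; case: c.2; rewrite valuation_inside // measure_itv_mass //; last lra.
by congr _%:E; ring.
Qed.

Lemma value_arc s x y : uniq (unzip1 s) -> x <= y ->
  value mu (arc s x y) = (arc_mass s y - arc_mass s x)%:E.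
Proof.
elim: s x y => [|c s IH] x y /=.
  by move=> _ _; rewrite /value subrr big1 // => e _; rewrite pset_nil measure0.
move=> /andP[cs us] xy; rewrite value_cat; last first.
  move=> e; rewrite (_ : _ `&` _ = set0) ?measure0 //.
  apply/seteqP; split=> z //= -[/clipP[<- _ _] /pset_arc_mem es].
  by rewrite es in cs.
rewrite value_clip // IH //; last by lra.
by rewrite -EFinD; congr _%:E; ring.
Qed.

End Valuation.
End Values.

(** * The division into an arc and its closed complement *)

Section Division.
Context {R : realType} {V E : finType} (src dst : E -> V).
Context (h : nat) (r : V) (s : seq (E * bool)).
Hypothesis s_preorder : preorder src dst h r s.
Hypothesis s_uniq : uniq (unzip1 s).
Hypothesis s_full : forall e, e \in unzip1 s.

(** Provides the representative for the component of the root: [s] lists some edge, and its first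
    one starts at the root. *)
Lemma root_point : E -> exists p : E * R, vertex_of src dst p = Some r.
Proof.
move=> e; have := s_full e.
case: s_preorder => [//|d c s1 s2 _ _ _]; exists (point c 0); exact: vertex_point0.
Qed.

Lemma value_whole_arc (mu : E -> {measure set R -> \bar R}) : valuation mu ->
  value mu (arc s 0 (size s)%:R) = 1%E.
Proof.
move=> [_ [_ <-]]; rewrite /value; apply: eq_bigr => e _; congr (mu e _).
apply/seteqP; split=> x /=; first by case/(pset_arcP _ _ _ s_uniq (s_full e)).
move=> x01; apply/(pset_arcP _ _ _ s_uniq (s_full e)); split=> //.
exact: pos_bounds.
Qed.

Section Cut.
Context (x y : R).
Hypotheses (x_ge0 : 0 <= x) (xy : x <= y) (y_le : y <= (size s)%:R).

Definition inner : piece R E := arc s x y.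
Definition outer : piece R E := arc s 0 x ++ arc s y (size s)%:R.

Lemma pset_inner e z : pset inner e z <-> 0 <= z <= 1 /\ x <= pos s e z <= y.
Proof. exact: pset_arcP. Qed.

Lemma pset_outer e z :
  pset outer e z <-> 0 <= z <= 1 /\ (pos s e z <= x \/ y <= pos s e z).
Proof.
rewrite pset_cat; split.
  by case=> /(pset_arcP _ _ _ s_uniq (s_full e))[? ?]; split=> //; [left|right]; lra.
move=> [z01 zxy]; have zs := pos_bounds (s_full e) z01.
by case: zxy => zxy; [left|right]; apply/(pset_arcP _ _ _ s_uniq (s_full e)); lra.
Qed.

(** Away from the ends of an edge no gluing occurs, so a common point has [pos] equal to [x] or [y].
    Injectivity of [pos] leaves at most one point per edge for each value. *)
Lemma division_inner_outer : division src dst inner outer.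
Proof.
split; first exact: wf_arc.
split; first by apply: wf_cat; exact: wf_arc.
split.
  move=> [e z] z01; have [zx|xz] := lerP (pos s e z) x.
    by right; apply: pset_inP; apply/pset_outer; split=> //; left.
  have [yz|zy] := lerP y (pos s e z).
    by right; apply: pset_inP; apply/pset_outer; split=> //; right.
  by left; apply: pset_inP; apply/pset_inner; split=> //; rewrite !ltW.
move=> e; pose fiber u : set R := [set z | pos s e z = u].
have fiber_fin u : finite_set (fiber u).
  have [->|/set0P[w wu]] := eqVneq (fiber u) set0; first exact: finite_set0.
  apply: sub_finite_set (finite_set1 w) => z zu /=.
  by apply: (pos_inj (s_full e)); rewrite zu wu.
apply: (@sub_finite_set _ _ ([set 0] `|` [set 1] `|` (fiber x `|` fiber y))); last first.
  by rewrite !finite_setU; do !split; rewrite ?finite_set1.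
move=> z /= [z01 [zin zout]].
have [z0|z0] := eqVneq z 0; first by left; left.
have [z1|z1] := eqVneq z 1; first by left; right.
have raw P : inP src dst P (e, z) -> pset P e z.
  move=> [q [[<- //|[v []]]]].
  by rewrite /vertex_of /= (negPf z0) (negPf z1).
have [_ zxy] := (pset_inner e z).1 (raw _ zin).
have [_ [zx|yz]] := (pset_outer e z).1 (raw _ zout); right; [left|right];
by apply/eqP; rewrite eq_le; lra.
Qed.

Lemma value_inner_outer (mu : E -> {measure set R -> \bar R}) : valuation mu ->
  value mu inner = (arc_mass mu s y - arc_mass mu s x)%:E /\
  value mu outer = (1 - (arc_mass mu s y - arc_mass mu s x))%:E.
Proof.
move=> muV; split; first exact: value_arc.
have whole := value_whole_arc muV.
rewrite value_arc ?ler0n // in whole; case: whole => whole.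
rewrite value_cat //; last first.
  (* The two parts of [outer] can meet only when [x = y], and then in at most one point of each
     edge, which is null. *)
  move=> e; set A := _ `&` _.
  have mA : measurable A by apply: measurableI; exact: measurable_pset.
  have [->|/set0P[z Az]] := eqVneq A set0; first exact: measure0.
  apply: (@subset_measure0 _ _ _ (mu e) _ [set z]) => //; last exact: valuation_atomless.
  have Ax w : A w -> pos s e w = x.
    move=> [/(pset_arcP _ _ _ s_uniq (s_full e))[_ /andP[_ wx]]].
    move=> /(pset_arcP _ _ _ s_uniq (s_full e))[_ /andP[yw _]].
    by apply/le_anti; rewrite wx (le_trans xy yw).
  by move=> w Aw /=; apply: (pos_inj (s_full e)); rewrite !Ax.
rewrite !value_arc // -EFinD; congr _%:E; move: whole; lra.
Qed.

Lemma inner_components : E -> at_most_components src dst inner h.+1.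
Proof.
move=> /root_point[p pr].
have [reps reps_h repsP] := arc_representatives (P := inner) s_preorder (fun e => @subset_refl _ _).
apply: (@at_most_components_reps _ _ _ _ _ _ _ (p :: reps)) => // e z /repsP[[q qr qz]|rz].
  by exists q; rewrite // inE qr orbT.
by exists p; [exact: mem_head|exact: rz].
Qed.

(** The initial arc lies entirely in the component of the root, so only the final arc contributes
    further representatives, at most [h]. *)
Lemma outer_components : E -> at_most_components src dst outer h.+1.
Proof.
move=> /root_point[p pr].
have sub1 e : pset (arc s 0 x) e `<=` pset outer e by rewrite pset_cat; exact: subsetUl.
have sub2 e : pset (arc s y (size s)%:R) e `<=` pset outer e.
  by rewrite pset_cat; exact: subsetUr.
have [reps reps_h repsP] := arc_representatives s_preorder sub2.
apply: (@at_most_components_reps _ _ _ _ _ _ _ (p :: reps)) => // e z.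
rewrite pset_cat => -[z1|/repsP[[q qr qz]|rz]].
- exists p; first exact: mem_head.
  exact: (initial_arc_reaches s_preorder (lexx _) sub1 z1).
- by exists q; rewrite // inE qr orbT.
- by exists p; [exact: mem_head|exact: rz].
Qed.

End Cut.
End Division.

(** * Exchange of the two shares and conclusion *)

Lemma division_sym (R : realType) (V E : finType) (src dst : E -> V) (P Q : piece R E) :
  division src dst P Q -> division src dst Q P.
Proof.
move=> [wP [wQ [PQ fin]]]; do 3 split=> //.
  by move=> p /PQ[]; [right|left].
move=> e; apply: sub_finite_set (fin e) => z /= [z01 [? ?]]; by split.
Qed.

Unset Implicit Arguments.

Theorem mainTheorem4 (R : realType) (V E : finType) (src dst : E -> V) (h : nat)
    (muA muB : E -> {measure set R -> \bar R}) (t : R) :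
  is_tree src dst -> minimal_height src dst h -> (1 <= h)%N ->
  valuation muA -> valuation muB -> 0 <= t <= 1 ->
  exists alpha beta : piece R E,
    weighted_consensus src dst muA muB t alpha beta /\
    at_most_components src dst alpha h.+1 /\ at_most_components src dst beta h.+1.
Proof.
move=> tree [[r r_height] _] _ VA VB t01.
(* Without edges the total mass would be an empty sum, hence 0 instead of 1. *)
have [e0 _] : exists e : E, true.
  case: (pickP (@predT E)) => [e _|noE]; first by exists e.
  case: VA => _ [_]; rewrite big1 => [/esym/eqP|e]; first by rewrite eqe oner_eq0.
  by have := noE e.
have [s [s_pre s_uniq s_full]] := preorder_exists tree r_height e0.
have hA := arc_mass_homo VA s; have hB := arc_mass_homo VB s.
have cA : continuous (arc_mass muA s) by apply: arc_mass_continuous.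
have cB : continuous (arc_mass muB s) by apply: arc_mass_continuous.
have wholeE mu : valuation mu -> arc_mass mu s (size s)%:R - arc_mass mu s 0 = 1.
  move=> Vmu; have := value_whole_arc s_uniq s_full Vmu.
  by rewrite value_arc ?ler0n // => -[].
(* Subtracting the value at 0 normalizes the functions to run from 0 to 1. *)
pose FA x := arc_mass muA s x - arc_mass muA s 0.
pose FB x := arc_mass muB s x - arc_mass muB s 0.
have [x [y [x0 xy yn Fxy]]] : exists x y, [/\ 0 <= x, x <= y, y <= (size s)%:R &
    (FA y - FA x = t /\ FB y - FB x = t) \/
    (FA y - FA x = 1 - t /\ FB y - FB x = 1 - t)].
  apply: common_increment => //; rewrite ?ler0n /FA /FB ?subrr ?wholeE //.
  - by move=> u; apply: cvgB; [exact: cA|exact: cvg_cst].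
  - by move=> u; apply: cvgB; [exact: cB|exact: cvg_cst].
  - by move=> u v uv; rewrite lerD2r hA.
  - by move=> u v uv; rewrite lerD2r hB.
have [inA outA] := value_inner_outer s_uniq s_full x0 xy yn VA.
have [inB outB] := value_inner_outer s_uniq s_full x0 xy yn VB.
have inC := inner_components s_pre s_full x y e0.
have outC := outer_components s_pre s_full x y e0.
have div : division src dst (inner s x y) (outer s x y) by apply: division_inner_outer.
case: Fxy => -[]; rewrite /FA /FB => At Bt.
- have {}At : arc_mass muA s y - arc_mass muA s x = t by lra.
  have {}Bt : arc_mass muB s y - arc_mass muB s x = t by lra.
  exists (inner s x y), (outer s x y).
  by rewrite /weighted_consensus inA inB outA outB At Bt.
(* Both agents value the arc at [1 - t], so its complement takes the role of [alpha]. *)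
- have {}At : arc_mass muA s y - arc_mass muA s x = 1 - t by lra.
  have {}Bt : arc_mass muB s y - arc_mass muB s x = 1 - t by lra.
  exists (outer s x y), (inner s x y).
  rewrite /weighted_consensus inA inB outA outB At Bt opprB addrC subrK.
  by split=> //; split=> //; exact: division_sym.
Qed.
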